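(* Let $G=(V,E)$ be a finite simple undirected graph, and let $\cong$ be the equivalence relation on $V$ given by $i\cong j$ if and only if $i\succeq j$ and $j\succeq i$, where $\succeq$ is the preorder defined in the context. Then the partition of $V$ into $\cong$-equivalence classes is the coarsest equitable partition of $G$.
   Context: $\mathbb{N}=\{1,2,3,\ldots\}$; $a\sim b$ means that $a,b\in V$ are neighbors in $G$; $\mathcal{N}(a)$ is the set of neighbors of $a$; $d(a)$ is the degree of $a$. For $\ell\in\mathbb{N}$ and $i\in V$, the set of paths (walks) of length $\ell$ departing from $i$ is $$\mathcal{P}_\ell(i)=\{(i_0,i_1,\ldots,i_\ell)\in V^{\ell+1} : i_0=i,\ i_k\sim i_{k+1}\ \text{for } 0\le k\le \ell-1\}.$$ For $0\le m\le \ell$, $\pi_{\le m}(x_0,x_1,\ldots,x_\ell)=(x_0,\ldots,x_m)$. For a vector of nodes $\mathbf{p}$, $\mathbf{d}(\mathbf{p})$ is the vector of the degrees of its entries; inequalities between vectors are componentwise. For $i,j\in V$ and $\ell\in\mathbb{N}$, a function $f^\ell_{ji}:\mathcal{P}_\ell(j)\to\mathcal{P}_\ell(i)$ is called $\ell$-adapted at $(j,i)$ if for all $\mathbf{p},\widetilde{\mathbf{p}}\in\mathcal{P}_\ell(j)$ and all $m\le\ell$: $\pi_{\le m}(\mathbf{p})=\pi_{\le m}(\widetilde{\mathbf{p}})$ implies $\pi_{\le m}(f^\ell_{ji}(\mathbf{p}))=\pi_{\le m}(f^\ell_{ji}(\widetilde{\mathbf{p}}))$, and $\pi_{\le m}(\mathbf{p})\ne\pi_{\le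 m}(\widetilde{\mathbf{p}})$ implies $\pi_{\le m}(f^\ell_{ji}(\mathbf{p}))\ne\pi_{\le m}(f^\ell_{ji}(\widetilde{\mathbf{p}}))$. An adapted sequence at $(j,i)$ is a sequence $(f^\ell_{ji})_{\ell\in\mathbb{N}}$ of $\ell$-adapted functions $f^\ell_{ji}:\mathcal{P}_\ell(j)\to\mathcal{P}_\ell(i)$ such that for every $\ell\in\mathbb{N}$, $f^{\ell+1}_{ji}$ extends $f^\ell_{ji}$, i.e. for all $\mathbf{p}\in\mathcal{P}_\ell(j)$ and $\mathbf{q}\in\mathcal{P}_{\ell+1}(j)$: if $\mathbf{p}=\pi_{\le\ell}(\mathbf{q})$ then $\pi_{\le\ell}(f^{\ell+1}_{ji}(\mathbf{q}))=f^\ell_{ji}(\mathbf{p})$, and if $\mathbf{p}\ne\pi_{\le\ell}(\mathbf{q})$ then $\pi_{\le\ell}(f^{\ell+1}_{ji}(\mathbf{q}))\ne f^\ell_{ji}(\mathbf{p})$. Definition of $\succeq$: $i\succeq j$ if there exists an adapted sequence $(f^\ell_{ji})_{\ell\in\mathbb{N}}$ at $(j,i)$ such that for all $\ell\in\mathbb{N}$, $f^\ell_{ji}$ is injective and $\mathbf{d}(f^\ell_{ji}(\mathbf{p}))\ge\mathbf{d}(\mathbf{p})$ for all $\mathbf{p}\in\mathcal{P}_\ell(j)$. This is a reflexive and transitive relation. Equitable partitions: for a partition $\mathcal{P}=\{\mathcal{P}_1,\ldots,\mathcal{P}_k\}$ of $V$, put $s_r(i)=|\mathcal{N}(i)\cap\mathcal{P}_r|$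 and $\mathbf{s}(i)=(s_1(i),\ldots,s_k(i))$. The partition $\mathcal{P}$ is equitable if for all $i,j\in V$: $i$ and $j$ lie in the same block of $\mathcal{P}$ if and only if $\mathbf{s}(i)=\mathbf{s}(j)$. The coarsest equitable partition of $G$ is the equitable partition that is coarser than (or equal to) every equitable partition of $G$. *)

(* Defs.v *)
From mathcomp Require Import all_boot.
From mathcomp Require Import boolp.

Set Implicit Arguments.
Unset Strict Implicit.
Unset Printing Implicit Defensive.

(* A finite simple undirected graph is an adjacency relation
   [e : rel V] on [V : finType], symmetric and irreflexive; these two
   properties are hypotheses of the theorem, not of the definitions. *)

Section Graph.
Variables (V : finType) (e : rel V).

Definition nbh (a : V) : {set V} := [set b | e a b].

Definition deg (a : V) : nat := #|nbh a|.

(* Walks with [l] edges departing from [i]: the [l.+1]-tuples whose first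
   entry is [i] and whose consecutive entries are adjacent. *)
Definition walk (l : nat) (i : V) : Type :=
  {p : l.+1.-tuple V | (thead p == i) && sorted e p}.

(* pi_{<= m}: the entries with indices 0, ..., m *)
Definition prefix_upto (m l : nat) (i : V) (p : walk l i) : seq V :=
  take m.+1 (val p).

Definition adapted (j i : V) (l : nat) (f : walk l j -> walk l i) : Prop :=
  forall (p p' : walk l j) (m : nat), m <= l ->
    (prefix_upto m p = prefix_upto m p' ->
       prefix_upto m (f p) = prefix_upto m (f p')) /\
    (prefix_upto m p <> prefix_upto m p' ->
       prefix_upto m (f p) <> prefix_upto m (f p')).

Definition extends (j i : V) (l : nat)
    (g : walk l.+1 j -> walk l.+1 i) (f : walk l j -> walk l i) : Prop :=
  forall (p : walk l j) (q : walk l.+1 j),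
    (val p = prefix_upto l q :> seq V ->
       prefix_upto l (g q) = val (f p) :> seq V) /\
    (val p <> prefix_upto l q :> seq V ->
       prefix_upto l (g q) <> val (f p) :> seq V).

(* Lengths start at 1, so the term of index [l] acts on walks of length
   [l.+1]. *)
Definition adapted_sequence (j i : V)
    (f : forall l : nat, walk l.+1 j -> walk l.+1 i) : Prop :=
  forall l : nat, adapted (f l) /\ extends (f l.+1) (f l).

Definition deg_le (l : nat) (j i : V) (p : walk l j) (q : walk l i) : Prop :=
  forall k : 'I_l.+1, deg (tnth (val p) k) <= deg (tnth (val q) k).

(* [dominates i j] is i >= j in the preorder on vertices: the maps go from
   walks departing from [j] to walks departing from [i]. *)
Definition dominates (i j : V) : Prop :=
  exists f : forall l : nat, walk l.+1 j -> walk l.+1 i,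
    adapted_sequence f /\
    forall l : nat,
      injective (f l) /\ forall p : walk l.+1 j, deg_le p (f l p).

Definition equidominant (i j : V) : Prop := dominates i j /\ dominates j i.

(* [dominates] quantifies over infinite sequences of maps, so the relation is
   made boolean classically. *)
Definition equidominance_classes : {set {set V}} :=
  equivalence_partition (fun i j => `[< equidominant i j >]) [set: V].

(* The vector (s_1(i), ..., s_k(i)); the blocks P_1, ..., P_k are listed in
   the order of [enum P]. *)
Definition block_degrees (P : {set {set V}}) (i : V) : seq nat :=
  [seq #|nbh i :&: B| | B <- enum P].

Definition equitable (P : {set {set V}}) : Prop :=
  partition P [set: V] /\
  forall i j : V,
    pblock P i = pblock P j <-> block_degrees P i = block_degrees P j.

(* [P] is coarser than or equal to [Q]. *)
Definition coarser (P Q : {set {set V}}) : Prop :=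
  forall B : {set V}, B \in Q -> exists2 C : {set V}, C \in P & B \subset C.

Definition coarsest_equitable (P : {set {set V}}) : Prop :=
  equitable P /\ forall Q : {set {set V}}, equitable Q -> coarser P Q.

End Graph.

(* Main.v *)
Require Import Defs.
From mathcomp Require Import all_boot.
From mathcomp Require Import boolp.

(** Walks departing from a vertex form a rooted tree in which a node ending at
[v] has one child for each neighbour of [v].  An adapted sequence of injections
at [(j, i)] is an embedding of the tree of [j] into the tree of [i] that
preserves depth and the parent relation.  It therefore has a local description:
the root sends the neighbours of [j] injectively to neighbours of [i], and below
each pair of matched neighbours there is again an embedding.  This makes
[dominates] the largest relation that is a simulation in this sense
([dominates_simulation], [simulation_dominates]).  Degrees do not decrease
along such an embedding, because matched vertices have injectively matched
neighbourhoods.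

If [i] and [j] dominate each other, composing the two matchings gives a
permutation of the neighbours of [j] that sends every vertex to one dominating
it.  Following a cycle of the permutation, the dominations close up, so that
each neighbour is equidominant to its match ([equidominant_match]).  Hence [i]
and [j] have equally many neighbours in each class
([equidominant_block_degrees]).

Conversely, take a partition in which vertices of the same block have equal
vectors of block degrees. Equality of these vectors is a simulation, since
neighbours can be matched inside each block; so it implies equidominance
([block_degrees_equidominant]). Applied to the classes themselves this shows
that vertices with equal vectors are in the same class; applied to any
equitable partition, it says that its blocks are contained in classes. *)

Set Implicit Arguments.
Unset Strict Implicit.
Unset Printing Implicit Defensive.

(** * Matchings between finite sets *)

(** Inside each block, the elements of [A] are sent to those of [A'] in the
order of enumeration. *)
Lemma blockwise_injection (V : finType) (P : {set {set V}}) (A A' : {set V}) :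
    partition P [set: V] ->
    (forall B, B \in P -> #|A :&: B| <= #|A' :&: B|) ->
  exists h : V -> V, [/\ {in A &, injective h},
    {in A, forall x, h x \in A'} & {in A, forall x, pblock P (h x) = pblock P x}].
Proof.
move=> partP leAA'; have [/eqP covP tiP _] := and3P partP.
have inP x : pblock P x \in P by rewrite pblock_mem // covP inE.
have inb x : x \in pblock P x by rewrite mem_pblock covP inE.
pose s x := enum (A :&: pblock P x); pose s' x := enum (A' :&: pblock P x).
pose h x := nth x (s' x) (index x (s x)).
have ltA x : x \in A -> index x (s x) < size (s' x).
  move=> xA; rewrite -cardE; apply: leq_trans (leAA' _ (inP x)).
  by rewrite cardE index_mem mem_enum inE xA inb.
have hs' x : x \in A -> h x \in A' :&: pblock P x.
  by move=> xA; rewrite -mem_enum mem_nth ?ltA.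
have hb x : x \in A -> pblock P (h x) = pblock P x.
  by move=> /hs'/setIP[_]; apply: same_pblock tiP.
exists h; split=> // [x y xA yA eqh|x /hs'/setIP[] //].
have eqb : pblock P x = pblock P y by rewrite -hb // eqh hb.
have eqs : s x = s y by rewrite /s eqb.
have eqs' : s' x = s' y by rewrite /s' eqb.
have ltx : index x (s y) < size (s' y) by rewrite -eqs -eqs' ltA.
move: eqh; rewrite /h eqs eqs' (set_nth_default y) // => /eqP.
rewrite nth_uniq ?enum_uniq ?ltA // => /eqP.
by apply: (index_inj x); rewrite mem_enum inE ?xA ?yA ?inb // -eqb inb.
Qed.

(** A finite permutation cannot strictly increase any element, because each
element lies on a cycle. *)
Lemma injection_cycle (V : finType) (T : V -> V -> Prop) (A : {set V})
    (g : V -> V) :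
    (forall x, T x x) -> (forall y x z, T x y -> T y z -> T x z) ->
    {in A &, injective g} -> {in A, forall x, g x \in A} ->
    {in A, forall x, T (g x) x} ->
  {in A, forall x, T x (g x)}.
Proof.
move=> Trefl Ttrans gI gA Tg x xA.
pose g' y := if y \in A then g y else y.
have g'I : injective g'.
  move=> y z; rewrite /g'; case: ifP => yA; case: ifP => zA //.
  - exact: gI.
  - by move=> eqz; rewrite -eqz gA in zA.
  - by move=> eqy; rewrite eqy gA in yA.
have Tg' y : T (g' y) y by rewrite /g'; case: ifP => yA; [apply: Tg|].
have Titer n y : T (iter n g' y) y.
  by elim: n => [|n IHn] //=; apply: Ttrans IHn.
have g'x : g' x = g x by rewrite /g' xA.
have := Titer (fingraph.order g' x).-1 (g' x).
by rewrite -iterSr prednK ?order_gt0 // iter_order // g'x.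
Qed.

Section Dominance.
Variables (V : finType) (e : rel V).

Local Notation nbh := (nbh e).
Local Notation deg := (deg e).
Local Notation walk := (walk e).
Local Notation dominates := (dominates e).
Local Notation equidominant := (equidominant e).

(** * Embeddings of walk trees *)

(** Embeddings of the tree of walks, written on sequences: a walk departing
from [j] is represented by the list of its later vertices, so that a single
function covers all lengths. *)
Definition tree_embedding (i j : V) (F : seq V -> seq V) : Prop :=
  [/\ forall s, path e j s -> path e i (F s),
      forall s, path e j s -> size (F s) = size s,
      forall s m, path e j s -> F (take m s) = take m (F s)
    & {in path e j &, injective F}].

Definition simulation (S : V -> V -> Prop) : Prop :=
  forall i j, S i j -> exists h : V -> V,
    [/\ {in nbh j &, injective h},
        {in nbh j, forall x, h x \in nbh i}
      & {in nbh j, forall x, S (h x) x}].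

Lemma path_take (j : V) m s : path e j s -> path e j (take m s).
Proof. by rewrite -{1}(cat_take_drop m s) cat_path => /andP[]. Qed.

Lemma walkP l i (p : walk l i) :
  exists s, [/\ tval (val p) = i :: s, path e i s & size s = l].
Proof.
case: p => -[[|x s] //= sz] /= /andP[/eqP xi pth]; exists s.
have {}xi : x = i by rewrite -xi.
by rewrite -xi pth; split=> //; apply/eqP.
Qed.

Lemma walk_of_path l i s :
  path e i s -> size s = l -> exists p : walk l i, tval (val p) = i :: s.
Proof.
move=> pth sz; have szt : size (i :: s) == l.+1 by rewrite /= sz.
have ok : (thead (Tuple szt) == i) && sorted e (Tuple szt).
  by rewrite /thead (tnth_nth i) /= eqxx.
by exists (exist _ (Tuple szt) ok).
Qed.

Lemma walk_inj l i (p q : walk l i) : tval (val p) = tval (val q) -> p = q.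
Proof. by move=> eqpq; apply/val_inj/val_inj. Qed.

Lemma dominates_embedding i j :
  dominates i j -> exists F, tree_embedding i j F.
Proof.
case=> f [adf injdeg].
(* The terms of the sequence start at length 1, so the walk of length 0 has to
   be added by hand. *)
pose R s t := path e j s -> (s = [::] /\ t = [::]) \/
  exists l (p : walk l.+1 j),
    tval (val p) = j :: s /\ tval (val (f l p)) = i :: t.
have /choice[F RF] : forall s, exists t, R s t.
  case=> [|x s]; first by exists [::]; left.
  have [pth|npth] := boolP (path e j (x :: s)); last first.
    by exists [::] => pth; rewrite pth in npth.
  have [p vp] := walk_of_path pth erefl.
  have [t [vt _ _]] := walkP (f _ p).
  by exists t; right; exists (size s), p.
have F0 : F [::] = [::].
  have [[//]|[l [p [vp _]]]] := RF [::] erefl.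
  by have := size_tuple (val p); rewrite vp.
have FS l (p : walk l.+1 j) s : tval (val p) = j :: s ->
    tval (val (f l p)) = i :: F s.
  move=> vp; have [s' [vp' pth sz]] := walkP p.
  have ? : s' = s by move: vp'; rewrite vp => -[].
  subst s'; have [[s0]|[l' [p' [vp2 vf]]]] := RF s pth.
    by rewrite s0 in sz.
  have [s2 [vs2 _ sz2]] := walkP p'.
  have ? : l = l'.
    by move: vs2; rewrite vp2 => -[ss2]; move: sz2; rewrite -ss2 sz => -[].
  subst l'; have -> : p = p' by apply: walk_inj; rewrite vp vp2.
  exact: vf.
have Fwalk s : path e j s -> path e i (F s) /\ size (F s) = size s.
  case: s => [|x s] pth; first by rewrite F0.
  have [p vp] := walk_of_path pth erefl.
  have [t [vt pt st]] := walkP (f _ p).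
  by move: vt; rewrite (FS _ _ _ vp) => -[->].
(* Consecutive terms of the sequence only compare walks that differ by one step;
   general prefixes follow by removing last vertices one at a time. *)
have Fbelast s x : path e j (rcons s x) -> F s = take (size s) (F (rcons s x)).
  case: s => [|y s] pth; first by rewrite take0.
  have pths : path e j (y :: s) by move: pth; rewrite rcons_path => /andP[].
  have [p vp] := walk_of_path pths erefl.
  have [q vq] := @walk_of_path (size s).+2 j _ pth (size_rcons _ _).
  have [+ _] := (adf (size s)).2 p q.
  rewrite /prefix_upto (FS _ _ _ vp) (FS _ _ _ vq) vp vq /=.
  by rewrite -cats1 take_size_cat // => /(_ erefl)[<-].
exists F; split=> [s /Fwalk[]//|s /Fwalk[]//|s m|s t].
  elim/last_ind: s m => [|s x IHs] m pth; first by rewrite F0.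
  have pths : path e j s by move: pth; rewrite rcons_path => /andP[].
  have [le_m|lt_m] := leqP m (size s).
    rewrite -cats1 takel_cat // IHs // (Fbelast s x) // cats1.
    by rewrite take_takel.
  have sz := (Fwalk _ pth).2.
  by rewrite !take_oversize ?sz // size_rcons.
rewrite /in_mem /= => ps pt eqF.
have eqsz : size s = size t.
  by rewrite -(Fwalk _ ps).2 eqF (Fwalk _ pt).2.
case: s t ps pt eqF eqsz => [|x s] [|y t] // ps pt eqF [eqsz].
have [p vp] := walk_of_path ps erefl.
have [q vq] := @walk_of_path (size s).+1 j _ pt (congr1 S (esym eqsz)).
have : p = q.
  by apply: (injdeg _).1; apply: walk_inj; rewrite (FS _ _ _ vp) (FS _ _ _ vq) eqF.
by move=> eqpq; move: vp; rewrite eqpq vq => -[-> ->].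
Qed.

Lemma embedding_dominates i j F :
    tree_embedding i j F ->
    (forall s k, path e j s -> k <= size s ->
       deg (nth j (j :: s) k) <= deg (nth j (i :: F s) k)) ->
  dominates i j.
Proof.
move=> [Fpath Fsize Ftake Finj] Fdeg.
have ex_f l (p : walk l.+1 j) :
    exists q : walk l.+1 i, tval (val q) = i :: F (behead (tval (val p))).
  have [s [-> pth sz]] := walkP p.
  by apply: walk_of_path; rewrite /= ?Fpath ?Fsize.
pose f l := projT1 (choice (ex_f l)).
have fE l p : tval (val (f l p)) = i :: F (behead (tval (val p))).
  exact: (projT2 (choice (ex_f l))).
exists f; split=> l; split.
- move=> p p' m _; rewrite /prefix_upto !fE.
  have [s [-> pth _]] := walkP p; have [s' [-> pth' _]] := walkP p'.
  rewrite /= -!Ftake //; split; first by case=> ->.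
  by move=> neq [eqF]; apply: neq; rewrite (Finj _ _ _ _ eqF) //;
    apply: path_take.
- move=> p q; rewrite /prefix_upto !fE.
  have [s [-> pth _]] := walkP p; have [s' [-> pth' _]] := walkP q.
  rewrite [behead _]/= [behead _]/= [take _ (j :: _)]/= [take _ (i :: _)]/=.
  rewrite -Ftake //; split; first by case=> ->.
  by move=> neq [eqF]; apply: neq; rewrite (Finj _ _ _ _ eqF) //;
    apply: path_take.
- move=> p q eqf; apply: walk_inj.
  have := fE l p; rewrite eqf fE.
  have [s [-> pth _]] := walkP p; have [s' [-> pth' _]] := walkP q.
  by case=> eqF; rewrite (Finj _ _ _ _ eqF).
- move=> p k; rewrite !(tnth_nth j) fE.
  by have [s [-> pth sz]] := walkP p; apply: Fdeg; rewrite // sz -ltnS.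
Qed.

(** * Dominance as the largest simulation *)

(** The embedding below the edge from [j] to [x] is obtained by deleting the
first step. *)
Lemma embedding_simulation :
  simulation (fun i j => exists F, tree_embedding i j F).
Proof.
move=> i j [F [Fpath Fsize Ftake Finj]].
pose h x := head x (F [:: x]).
have path1 x : x \in nbh j -> path e j [:: x] by rewrite inE /= andbT.
have hE x : x \in nbh j -> F [:: x] = [:: h x].
  move=> /path1 jx; rewrite /h; have := Fsize _ jx.
  by case: (F _) => [|y [|z s]].
have FE x s : path e j (x :: s) -> F (x :: s) = h x :: behead (F (x :: s)).
  move=> pth; have jx : x \in nbh j by rewrite inE; case/andP: pth.
  have := Ftake _ 1 pth; rewrite /= take0 hE //.
  by case: (F (x :: s)) => [|y t] //=; rewrite take0 => -[->].
exists h; split=> [x y xj yj eqh|x xj|x xj].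
- suff [] : [:: x] = [:: y] by [].
  by apply: Finj; rewrite ?hE ?eqh //; apply: path1.
- by have := Fpath _ (path1 _ xj); rewrite hE //= andbT inE.
have consp s : path e x s -> path e j (x :: s) by rewrite /= inE in xj *; rewrite xj.
exists (fun s => behead (F (x :: s))); split=> [s ps|s ps|s m ps|s t ps pt eqF].
- by have := Fpath _ (consp s ps); rewrite FE ?consp //= => /andP[].
- by rewrite size_behead Fsize ?consp.
- rewrite -[x :: take m s]/(take m.+1 (x :: s)) Ftake ?consp //.
  by rewrite (FE _ _ (consp s ps)).
suff [] : x :: s = x :: t by [].
apply: Finj; [exact: consp ps | exact: consp pt |].
by rewrite (FE x s (consp s ps)) eqF -FE ?consp.
Qed.

Lemma simulation_deg S : simulation S -> forall i j, S i j -> deg j <= deg i.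
Proof.
move=> simS i j /simS[h [hI hN _]].
rewrite /Defs.deg -(card_in_imset hI); apply/subset_leq_card/subsetP.
by move=> _ /imsetP[x xj ->]; apply: hN.
Qed.

Section Follow.
Variables (S : V -> V -> Prop) (h : V -> V -> V -> V).
Hypothesis hP : forall i j, S i j ->
  [/\ {in nbh j &, injective (h i j)},
      {in nbh j, forall x, h i j x \in nbh i}
    & {in nbh j, forall x, S (h i j x) x}].

(** The matching used at each step depends only on the current pair of vertices,
never on later ones: hence the map commutes with taking prefixes. *)
Fixpoint follow (i j : V) (s : seq V) : seq V :=
  if s is x :: s' then h i j x :: follow (h i j x) x s' else [::].

Lemma follow_embedding i j : S i j -> tree_embedding i j (follow i j).
Proof.
move=> Sij; split=> [s|s _|s m _|s t].
- elim: s i j Sij => //= x s IHs i j Sij /andP[jx ps].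
  have [_ hN hS] := hP Sij; have xj : x \in nbh j by rewrite inE.
  by have := hN _ xj; rewrite inE => ->; rewrite IHs //; apply: hS.
- by elim: s i j {Sij} => //= x s IHs i j; rewrite IHs.
- elim: s m i j {Sij} => [|x s IHs] [|m] i j //=.
  by rewrite IHs.
rewrite /in_mem /=; elim: s t i j Sij => [|x s IHs] [|y t] i j Sij //=.
move=> /andP[jx ps] /andP[jy pt] [eqh eqF].
have [hI _ hS] := hP Sij.
have xj : x \in nbh j by rewrite inE.
have yj : y \in nbh j by rewrite inE.
have eqxy := hI _ _ xj yj eqh; rewrite -eqxy in pt eqF *.
by congr (_ :: _); apply: IHs eqF => //; apply: hS.
Qed.

Lemma follow_deg x0 i j s k : S i j -> path e j s -> k <= size s ->
  deg (nth x0 (j :: s) k) <= deg (nth x0 (i :: follow i j s) k).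
Proof.
have simS : simulation S by move=> a b /hP ?; exists (h a b).
elim: s i j k => [|x s IHs] i j [|k] Sij //= ; try by rewrite (simulation_deg simS).
move=> /andP[jx ps] le_k; apply: IHs => //.
by have [_ _ hS] := hP Sij; apply: hS; rewrite inE.
Qed.

End Follow.

(** The local matchings of a simulation, chosen once for every pair of vertices,
are applied step by step along a walk. *)
Lemma simulation_dominates S : simulation S -> forall i j, S i j -> dominates i j.
Proof.
move=> simS.
have /choice[h hP] : forall ij : V * V, exists h : V -> V, S ij.1 ij.2 ->
    [/\ {in nbh ij.2 &, injective h},
        {in nbh ij.2, forall x, h x \in nbh ij.1}
      & {in nbh ij.2, forall x, S (h x) x}].
  move=> [i j] /=; have [Sij|nSij] := pselect (S i j).
    by have [h ?] := simS _ _ Sij; exists h.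
  by exists id.
have {}hP i j : S i j -> _ := hP (i, j).
move=> i j Sij.
apply: (embedding_dominates (F := follow (fun a b => h (a, b)) i j)).
  exact: follow_embedding Sij.
by move=> s k; apply: (follow_deg (S := S)).
Qed.

Lemma dominates_simulation : simulation dominates.
Proof.
move=> i j /dominates_embedding/embedding_simulation[h [hI hN hS]].
exists h; split=> // x /hS.
exact: (simulation_dominates embedding_simulation).
Qed.

Lemma dominates_refl i : dominates i i.
Proof.
apply: (simulation_dominates (S := eq)) => // a _ <-.
by exists id; split.
Qed.

Lemma dominates_trans j i k : dominates i j -> dominates j k -> dominates i k.
Proof.
move=> ij jk.
pose S a c := exists2 b, dominates a b & dominates b c.
apply: (simulation_dominates (S := S)); last by exists j.
move=> a c [b /dominates_simulation[h [hI hN hS]]].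
move=> /dominates_simulation[g [gI gN gS]].
exists (h \o g); split=> [x y xc yc /= eqh|x xc|x xc] /=.
- by apply: gI => //; apply: hI eqh; apply: gN.
- by apply/hN/gN.
- by exists (g x); [apply/hS/gN | apply: gS].
Qed.

(** * Equidominance and block degrees *)

Lemma equidominant_refl i : equidominant i i.
Proof. by split; apply: dominates_refl. Qed.

Lemma equidominant_sym i j : equidominant i j -> equidominant j i.
Proof. by case. Qed.

Lemma equidominant_trans j i k :
  equidominant i j -> equidominant j k -> equidominant i k.
Proof.
move=> [ij ji] [jk kj].
by split; [apply: dominates_trans jk | apply: dominates_trans ji].
Qed.

(** Going back and forth between the neighbourhoods permutes the neighbours of
[j]; since no vertex is strictly increased by a permutation, the two
dominations met on the way are reversible. *)
Lemma equidominant_match i j : equidominant i j ->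
  exists h : V -> V, [/\ {in nbh j &, injective h},
    {in nbh j, forall x, h x \in nbh i}
    & {in nbh j, forall x, equidominant (h x) x}].
Proof.
move=> [/dominates_simulation[h [hI hN hS]] /dominates_simulation[g [gI gN gS]]].
exists h; split=> // x xj; split; first exact: hS.
apply: (dominates_trans (j := g (h x))); last by apply/gS/hN.
apply: (@injection_cycle V dominates (nbh j) (g \o h)) => //.
- exact: dominates_refl.
- exact: dominates_trans.
- by move=> y z yj zj /= eqg; apply: hI => //; apply: gI eqg; apply: hN.
- by move=> y yj; apply/gN/hN.
by move=> y yj; apply: dominates_trans (hS _ yj); apply/gS/hN.
Qed.

Lemma block_degreesP (P : {set {set V}}) i j :
  block_degrees e P i = block_degrees e P j <->
  forall B, B \in P -> #|nbh i :&: B| = #|nbh j :&: B|.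
Proof.
rewrite /block_degrees; split=> [/eq_in_map eqP B BP|eqP].
  by apply: eqP; rewrite mem_enum.
by apply/eq_in_map => B; rewrite mem_enum; apply: eqP.
Qed.

(** Equal block degrees let neighbours be matched within blocks, where block
degrees are again equal by assumption: this equality is itself a simulation,
and a symmetric one. *)
Lemma block_degrees_equidominant (P : {set {set V}}) :
    partition P [set: V] ->
    (forall i j, pblock P i = pblock P j ->
       block_degrees e P i = block_degrees e P j) ->
  forall i j, block_degrees e P i = block_degrees e P j -> equidominant i j.
Proof.
move=> partP eqP.
have domP i j : block_degrees e P i = block_degrees e P j -> dominates i j.
  pose S a b := block_degrees e P a = block_degrees e P b.
  apply: (simulation_dominates (S := S)).
  move=> a b /block_degreesP eqab.
  have [|h [hI hN hb]] := @blockwise_injection V P (nbh b) (nbh a) partP.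
    by move=> B /eqab ->.
  by exists h; split=> // x /hb/eqP.
by move=> i j eqij; split; apply: domP.
Qed.

Local Notation classes := (equidominance_classes e).

Lemma equidominance_equivalence :
  {in [set: V] & &, equivalence_rel (fun i j => `[< equidominant i j >])}.
Proof.
move=> x y z _ _ _; split; first by apply/asboolP/equidominant_refl.
move=> /asboolP xy; apply/asboolP/asboolP => [xz|yz].
  exact: equidominant_trans (equidominant_sym xy) xz.
exact: equidominant_trans xy yz.
Qed.

Lemma equidominance_classes_partition : partition classes [set: V].
Proof. exact: equivalence_partitionP equidominance_equivalence. Qed.

Lemma mem_equidominance_class i j :
  j \in pblock classes i <-> equidominant i j.
Proof.
have eqR := equidominance_equivalence.
rewrite (pblock_equivalence_partition eqR) ?inE //.
by split=> /asboolP.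
Qed.

Lemma eq_equidominance_class i j :
  pblock classes i = pblock classes j <-> equidominant i j.
Proof.
have /and3P[/eqP cov ti _] := equidominance_classes_partition.
rewrite -mem_equidominance_class.
have -> : (j \in pblock classes i) = (pblock classes i == pblock classes j).
  by rewrite eq_pblock // cov inE.
by split=> /eqP.
Qed.

Lemma equidominant_block_degrees i j :
  equidominant i j -> block_degrees e classes i = block_degrees e classes j.
Proof.
have /and3P[_ ti _] := equidominance_classes_partition.
have le_deg a b B : B \in classes -> equidominant a b ->
    #|nbh b :&: B| <= #|nbh a :&: B|.
  move=> BP /equidominant_match[h [hI hN hE]].
  have hIB : {in nbh b :&: B &, injective h}.
    by move=> x y /setIP[xb _] /setIP[yb _]; apply: hI.
  rewrite -(card_in_imset hIB); apply/subset_leq_card/subsetP.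
  move=> _ /imsetP[x /setIP[xb xB] ->]; rewrite inE hN //=.
  rewrite -(def_pblock ti BP xB).
  by apply/mem_equidominance_class/equidominant_sym/hE.
move=> ij; apply/block_degreesP => B BP; apply/eqP.
by rewrite eqn_leq !le_deg //; apply: equidominant_sym.
Qed.

End Dominance.

Theorem theorem16 (V : finType) (e : rel V)
    (e_sym : symmetric e) (e_irr : irreflexive e) :
  coarsest_equitable e (equidominance_classes e).
Proof.
have partC := equidominance_classes_partition e.
split.
  split=> // i j; rewrite eq_equidominance_class; split.
    exact: equidominant_block_degrees.
  apply: block_degrees_equidominant => // a b /eq_equidominance_class.
  exact: equidominant_block_degrees.
move=> Q [partQ eqQ] B BQ.
have [_ tiQ /memPn/(_ _ BQ)/set0Pn[x xB]] := and3P partQ.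
have /and3P[/eqP covC _ _] := partC.
exists (pblock (equidominance_classes e) x).
  by rewrite pblock_mem // covC inE.
apply/subsetP => y yB; apply/mem_equidominance_class.
apply: (block_degrees_equidominant partQ) => [a b|]; first by case: (eqQ a b).
by apply/eqQ; rewrite !(def_pblock tiQ BQ).
Qed.
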